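(* There exist an isomorphism from $U_{AB}\times\mathbb{A}(L)$ to $U_{AB}\times\mathbb{A}(P)$ and an isomorphism from $\widetilde{\Pi}_{\mathbb{A}}^{15}\cap\{(A-B)(2A+B)(A+2B)\neq0\}$ to $U_{AB}\times H_{\mathbb{A}}^{13}$ which fit into a commutative diagram with the projections $$p_{\Pi}\colon\widetilde{\Pi}_{\mathbb{A}}^{15}\cap\{(A-B)(2A+B)(A+2B)\neq0\}\to U_{AB}\times\mathbb{A}(L),\qquad {\rm id}\times p_H\colon U_{AB}\times H_{\mathbb{A}}^{13}\to U_{AB}\times\mathbb{A}(P),$$ that is, the composite $\widetilde{\Pi}_{\mathbb{A}}^{15}\cap\{(A-B)(2A+B)(A+2B)\neq0\}\to U_{AB}\times H_{\mathbb{A}}^{13}\to U_{AB}\times\mathbb{A}(P)$ equals the composite $\widetilde{\Pi}_{\mathbb{A}}^{15}\cap\{(A-B)(2A+B)(A+2B)\neq0\}\to U_{AB}\times\mathbb{A}(L)\to U_{AB}\times\mathbb{A}(P)$.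
   Context: We work over $\mathbb{C}$. Let $\mathbb{A}^{19}$ have coordinates $p_1,p_2,p_3,p_4,u,v,t_1,t_2$, $L_{123},L_{124},L_{125},L_{126},L_{135},L_{136},L_{245},L_{246}$, $s_1,s_2,s_3$. Abbreviate $\Delta=p_1p_4-p_2p_3$, $\lambda(X,Y,Z)=L_{136}X+L_{245}Y+L_{246}Z$, $\mu(X,Y,Z)=L_{135}X+L_{136}Y+L_{245}Z$, $U_1=p_1^2+t_1p_2^2+p_2u$, $U_2=2p_1p_3+2t_1p_2p_4+p_4u+p_2v$, $U_3=p_3^2+t_1p_4^2+p_4v$, $I_1=t_2p_2^2+p_1u$, $I_2=2t_2p_2p_4+p_3u+p_1v$, $I_3=t_2p_4^2+p_3v$, $W_1=t_1p_2u-t_2p_1p_2+u^2$, $W_2=t_1(p_4u+p_2v)-t_2(p_2p_3+p_1p_4)+2uv$, $W_3=t_1p_4v-t_2p_3p_4+v^2$, $\kappa_1=L_{135}L_{245}-L_{136}^2$, $\kappa_2=L_{135}L_{246}-L_{136}L_{245}$, $\kappa_3=L_{136}L_{246}-L_{245}^2$. Then $\Pi_{\mathbb{A}}^{15}\subset\mathbb{A}^{19}$ is the affine scheme defined by the nine polynomials \begin{align*} F_1&=us_1-p_1s_2-p_2s_3-L_{126}\Delta-\lambda(U_1,U_2,U_3),\\ F_2&=vs_1-p_3s_2-p_4s_3+L_{125}\Delta+\mu(U_1,U_2,U_3),\\ F_3&=-t_2p_2s_1+(u+t_1p_2)s_2-p_1s_3-L_{124}\Delta-\lambda(I_1,I_2,I_3),\\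 F_4&=-t_2p_4s_1+(v+t_1p_4)s_2-p_3s_3+L_{123}\Delta+\mu(I_1,I_2,I_3),\\ F_5&=-t_2p_1s_1+(t_1p_1-t_2p_2)s_2+(u+t_1p_2)s_3+L_{123}U_1+L_{124}(p_1p_3+t_1p_2p_4+p_2v)\\&\quad-L_{125}I_1-L_{126}(t_2p_2p_4+p_1v)-\lambda(W_1,W_2,W_3),\\ F_6&=-t_2p_3s_1+(t_1p_3-t_2p_4)s_2+(v+t_1p_4)s_3+L_{123}(p_1p_3+t_1p_2p_4+p_4u)+L_{124}U_3\\&\quad-L_{125}(t_2p_2p_4+p_3u)-L_{126}I_3+\mu(W_1,W_2,W_3),\\ F_7&=-s_2^2+s_1s_3+(L_{123}p_2+L_{124}p_4)s_1-(L_{125}p_2+L_{126}p_4)s_2\\&\quad+L_{123}\lambda(p_2^2,2p_2p_4,p_4^2)-L_{124}\mu(p_2^2,2p_2p_4,p_4^2)\\&\quad-L_{125}\lambda(p_1p_2,p_2p_3+p_1p_4,p_3p_4)+L_{126}\mu(p_1p_2,p_2p_3+p_1p_4,p_3p_4)\\&\quad+\kappa_1(-p_1^2+2up_2+t_1p_2^2)+\kappa_2(-p_1p_3+up_4+vp_2+t_1p_2p_4)+\kappa_3(-p_3^2+2vp_4+t_1p_4^2),\\ F_8&=s_2s_3+t_1s_1s_2-t_2s_1^2+s_1(L_{123}p_1+L_{124}p_3)-s_2(L_{125}p_1+L_{126}p_3)\\&\quad+L_{123}\lambda(p_1p_2,p_1p_4+p_2p_3,p_3p_4)-L_{124}\mu(p_1p_2,p_1p_4+p_2p_3,p_3p_4)\\&\quad-L_{125}\lambda(p_1^2,2p_1p_3,p_3^2)+L_{126}\mu(p_1^2,2p_1p_3,p_3^2)\\&\quad+\kappa_1(2up_1+2t_1p_1p_2-t_2p_2^2)+\kappa_2(vp_1+up_3+t_1(p_1p_4+p_2p_3)-t_2p_2p_4)+\kappa_3(2vp_3+2t_1p_3p_4-t_2p_4^2),\\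 F_9&=t_1s_2^2+s_3^2-t_2s_1s_2+s_1(L_{123}u+L_{124}v)-s_2(L_{125}u+L_{126}v)+(L_{124}L_{125}-L_{123}L_{126})\Delta\\&\quad-L_{123}\lambda(p_1^2+t_1p_2^2,\,2p_1p_3+2t_1p_2p_4,\,p_3^2+t_1p_4^2)+L_{124}\mu(p_1^2+t_1p_2^2,\,2p_1p_3+2t_1p_2p_4,\,p_3^2+t_1p_4^2)\\&\quad+t_2L_{125}\lambda(p_2^2,2p_2p_4,p_4^2)-t_2L_{126}\mu(p_2^2,2p_2p_4,p_4^2)\\&\quad+\kappa_1(u^2+2t_2p_1p_2)+\kappa_2(uv+t_2(p_2p_3+p_1p_4))+\kappa_3(v^2+2t_2p_3p_4). \end{align*} $\mathbb{A}(L)$ is the affine space with coordinates $L_{123},L_{124},L_{125},L_{126},L_{135},L_{136},L_{245},L_{246}$; $\mathbb{A}_{\Pi}^{10}$ is the affine space with coordinates $t_1,t_2$ and these $L$'s; $\mathbb{A}(A,B)$ is the affine plane with coordinates $A,B$; $U_{AB}=\{(A-B)(2A+B)(A+2B)\neq0\}\subset\mathbb{A}(A,B)$; $\widetilde{\mathbb{A}}_{\Pi}^{10}=\mathbb{A}(A,B)\times\mathbb{A}(L)$. Let $b\colon\widetilde{\mathbb{A}}_{\Pi}^{10}\to\mathbb{A}_{\Pi}^{10}$ be the (finite, degree six) morphism given by $t_1=-A^2-AB-B^2$, $t_2=-AB(A+B)$ and the identity on the $L$'s. Put $\widetilde{\Pi}_{\mathbb{A}}^{15}:=\Pi_{\mathbb{A}}^{15}\times_{\mathbb{A}_{\Pi}^{10}}\widetilde{\mathbb{A}}_{\Pi}^{10}$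 (via the coordinate projection $\Pi_{\mathbb{A}}^{15}\to\mathbb{A}_{\Pi}^{10}$ and $b$), and let $p_{\Pi}\colon\widetilde{\Pi}_{\mathbb{A}}^{15}\to\widetilde{\mathbb{A}}_{\Pi}^{10}$ be the induced morphism. **The variety $H_{\mathbb{A}}^{13}$.** Let $\mathbb{A}(P)$ be the affine $8$-space with coordinates $p_{ijk}$ ($1\le i,j,k\le2$). Let $\mathbb{A}^{17}$ have coordinates $\bm{x}_i=\begin{pmatrix} x_{1i} \\ x_{2i} \end{pmatrix}$ ($i=1,2,3$), $p_{ijk}$, and $u_1,u_2,u_3$. For $j,k\in\{1,2\}$ set $D^{(1)}_{jk}=\begin{vmatrix} p_{1jk} & x_{11} \\ p_{2jk} & x_{21} \end{vmatrix}$, $D^{(2)}_{jk}=\begin{vmatrix} p_{j1k} & x_{12} \\ p_{j2k} & x_{22} \end{vmatrix}$, $D^{(3)}_{jk}=\begin{vmatrix} p_{jk1} & x_{13} \\ p_{jk2} & x_{23} \end{vmatrix}$. $H_{\mathbb{A}}^{13}\subset\mathbb{A}^{17}$ is defined by \begin{align*} &u_1\bm{x}_1=\begin{pmatrix}-D_{12}^{(3)}&D_{11}^{(3)}\\-D_{22}^{(3)}&D_{21}^{(3)}\end{pmatrix}\bm{x}_2,\quad u_2\bm{x}_2=\begin{pmatrix}-D_{12}^{(1)}&D_{11}^{(1)}\\-D_{22}^{(1)}&D_{21}^{(1)}\end{pmatrix}\bm{x}_3,\quad u_3\bm{x}_3=\begin{pmatrix}-D_{21}^{(2)}&D_{11}^{(2)}\\-D_{22}^{(2)}&D_{12}^{(2)}\end{pmatrix}\bm{x}_1,\\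 &u_1u_2=D_{12}^{(3)}D_{21}^{(3)}-D_{11}^{(3)}D_{22}^{(3)},\quad u_2u_3=D_{12}^{(1)}D_{21}^{(1)}-D_{11}^{(1)}D_{22}^{(1)},\quad u_3u_1=D_{12}^{(2)}D_{21}^{(2)}-D_{11}^{(2)}D_{22}^{(2)}. \end{align*} $p_H\colon H_{\mathbb{A}}^{13}\to\mathbb{A}(P)$ is the natural projection. *)

(* Defs.v *)
From mathcomp Require Import all_boot all_order all_algebra.
From mathcomp Require Import boolp reals.
From mathcomp Require Import complex ring.

Set Implicit Arguments.
Unset Strict Implicit.
Unset Printing Implicit Defensive.

Import GRing.Theory.
Local Open Scope ring_scope.

Local Obligation Tactic := try by [].

(* Affine schemes over K are handled through their functors of points on
   commutative K-algebras: Spec A is R |-> Hom_K(A, R), a morphism of schemes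
   is a natural transformation (Yoneda), and closed subschemes, basic opens,
   products and fibre products are computed pointwise.  A [comAlgType K] is
   nonzero; nothing is lost, since every functor below would take a one-point
   value on the zero algebra.  Nilpotents are seen because R ranges over all
   algebras, not just over fields. *)

Record functor (K : comNzRingType) := Functor {
  points :> comAlgType K -> Type;
  fmap : forall R S : comAlgType K, {lrmorphism R -> S} -> points R -> points S;
  fmap_id : forall (R : comAlgType K) (x : points R),
    fmap (idfun : {lrmorphism R -> R}) x = x;
  fmap_comp : forall (R S T : comAlgType K) (f : {lrmorphism R -> S})
    (g : {lrmorphism S -> T}) (x : points R),
    fmap (g \o f : {lrmorphism R -> T}) x = fmap g (fmap f x) }.

Arguments fmap {K} X {R S} f x : rename.

Record morphism (K : comNzRingType) (X Y : functor K) := Morphism {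
  mapp :> forall R : comAlgType K, X R -> Y R;
  natural : forall (R S : comAlgType K) (f : {lrmorphism R -> S}) (x : X R),
    mapp (fmap X f x) = fmap Y f (mapp x) }.

Arguments mapp {K X Y} m {R} x : rename.

Definition eq_morphism (K : comNzRingType) (X Y : functor K)
    (f g : morphism X Y) : Prop :=
  forall (R : comAlgType K) (x : X R), f R x = g R x.

Program Definition id_morphism (K : comNzRingType) (X : functor K) :
  morphism X X := Morphism (mapp := fun R x => x) _.

Program Definition comp_morphism (K : comNzRingType) (X Y Z : functor K)
    (g : morphism Y Z) (f : morphism X Y) : morphism X Z :=
  Morphism (mapp := fun R x => g R (f R x)) _.
Next Obligation. by move=> K X Y Z g f R S h x; rewrite /= !natural. Qed.

Definition is_isomorphism (K : comNzRingType) (X Y : functor K)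
    (f : morphism X Y) : Prop :=
  exists g : morphism Y X,
    eq_morphism (comp_morphism g f) (id_morphism X) /\
    eq_morphism (comp_morphism f g) (id_morphism Y).

Program Definition affine_space (K : comNzRingType) (I : Type) : functor K :=
  Functor (points := fun R => I -> R) (fmap := fun R S f x => f \o x) _ _.

Program Definition subfunctor (K : comNzRingType) (X : functor K)
    (P : forall R : comAlgType K, X R -> Prop)
    (stable : forall (R S : comAlgType K) (f : {lrmorphism R -> S}) (x : X R),
       P R x -> P S (fmap X f x)) : functor K :=
  Functor (points := fun R => {x : X R | P R x})
    (fmap := fun R S f x => exist _ (fmap X f (sval x)) _) _ _.
Next Obligation. by move=> K X P st R S f [x Px]; apply: st. Qed.
Next Obligation. by move=> K X P st R [x Px]; apply: eq_exist; rewrite fmap_id. Qed.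
Next Obligation.
by move=> K X P st R S T f g [x Px]; apply: eq_exist; rewrite fmap_comp.
Qed.

Program Definition inclusion (K : comNzRingType) (X : functor K)
    (P : forall R : comAlgType K, X R -> Prop)
    (stable : forall (R S : comAlgType K) (f : {lrmorphism R -> S}) (x : X R),
       P R x -> P S (fmap X f x)) : morphism (subfunctor stable) X :=
  Morphism (mapp := fun R x => sval x) _.

Program Definition product (K : comNzRingType) (X Y : functor K) : functor K :=
  Functor (points := fun R => (X R * Y R)%type)
    (fmap := fun R S f z => (fmap X f z.1, fmap Y f z.2)) _ _.
Next Obligation. by move=> K X Y R [x y]; rewrite /= !fmap_id. Qed.
Next Obligation. by move=> K X Y R S T f g [x y]; rewrite /= !fmap_comp. Qed.

Program Definition proj1 (K : comNzRingType) (X Y : functor K) :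
  morphism (product X Y) X := Morphism (mapp := fun R z => z.1) _.

Program Definition proj2 (K : comNzRingType) (X Y : functor K) :
  morphism (product X Y) Y := Morphism (mapp := fun R z => z.2) _.

Program Definition pairing (K : comNzRingType) (T X Y : functor K)
    (f : morphism T X) (g : morphism T Y) : morphism T (product X Y) :=
  Morphism (mapp := fun R z => (f R z, g R z)) _.
Next Obligation. by move=> K T X Y f g R S h z; rewrite /= !natural. Qed.

Definition id_times (K : comNzRingType) (Z X Y : functor K)
    (f : morphism X Y) : morphism (product Z X) (product Z Y) :=
  pairing (proj1 Z X) (comp_morphism f (proj2 Z X)).

Lemma fibre_product_stable (K : comNzRingType) (X Y Z : functor K)
    (f : morphism X Z) (g : morphism Y Z)
    (R S : comAlgType K) (h : {lrmorphism R -> S}) (z : product X Y R) :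
  f R z.1 = g R z.2 ->
  f S (fmap (product X Y) h z).1 = g S (fmap (product X Y) h z).2.
Proof. by move=> fg; rewrite /= !natural fg. Qed.

Definition fibre_product (K : comNzRingType) (X Y Z : functor K)
    (f : morphism X Z) (g : morphism Y Z) : functor K :=
  subfunctor (X := product X Y) (P := fun R z => f R z.1 = g R z.2)
    (fibre_product_stable (f := f) (g := g)).

Definition fibre_proj2 (K : comNzRingType) (X Y Z : functor K)
    (f : morphism X Z) (g : morphism Y Z) : morphism (fibre_product f g) Y :=
  comp_morphism (proj2 X Y) (inclusion (fibre_product_stable (f := f) (g := g))).

(* The affine line, so that regular functions on X are morphisms to it. *)
Program Definition affine_line (K : comNzRingType) : functor K :=
  Functor (points := fun R => (R : Type)) (fmap := fun R S f x => f x) _ _.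

(* The open subscheme {d != 0}: an R-point of X lies in it iff the value of d
   there is invertible in R. *)
Lemma basic_open_stable (K : comNzRingType) (X : functor K)
    (d : morphism X (affine_line K))
    (R S : comAlgType K) (h : {lrmorphism R -> S}) (x : X R) :
  (exists w : R, w * d R x = 1) -> exists w : S, w * d S (fmap X h x) = 1.
Proof. by case=> w wd; exists (h w); rewrite natural -rmorphM wd rmorph1. Qed.

Definition basic_open (K : comNzRingType) (X : functor K)
    (d : morphism X (affine_line K)) : functor K :=
  subfunctor (X := X) (P := fun R x => exists w : R, w * d R x = 1)
    (basic_open_stable (d := d)).

Definition open_inclusion (K : comNzRingType) (X : functor K)
    (d : morphism X (affine_line K)) : morphism (basic_open d) X :=
  inclusion (basic_open_stable (d := d)).

Program Definition open_restriction (K : comNzRingType) (X Y : functor K)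
    (f : morphism X Y) (d : morphism Y (affine_line K)) :
    morphism (basic_open (comp_morphism d f)) (basic_open d) :=
  Morphism (mapp := fun R x => exist _ (f R (sval x)) (svalP x)) _.
Next Obligation. by move=> K X Y f d R S h x; apply: eq_exist; rewrite natural. Qed.

(* Indices i, j, k in {1,2} (resp. {1,2,3}) of the mathematical notation are
   shifted to 'I_2 = {0,1} (resp. 'I_3 = {0,1,2}). *)

Inductive L_coord :=
  | L123 | L124 | L125 | L126 | L135 | L136 | L245 | L246.
Inductive AB_coord := cA | cB.
Inductive base_coord := t1 | t2 | base_L of L_coord.
Inductive Pi_coord :=
  | p1 | p2 | p3 | p4 | pu | pv | s1 | s2 | s3 | Pi_base of base_coord.
Inductive P_coord := cp of 'I_2 & 'I_2 & 'I_2.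
Inductive H_coord :=
  | Hx of 'I_2 & 'I_3 (* [Hx a i] is the entry x_{ai} of the vector x_i *)
  | Hp of P_coord
  | Hu of 'I_3.

Section PiEquations.
Variables (K : comNzRingType) (R : comAlgType K) (x : Pi_coord -> R).

Local Notation p1 := (x p1).
Local Notation p2 := (x p2).
Local Notation p3 := (x p3).
Local Notation p4 := (x p4).
Local Notation u := (x pu).
Local Notation v := (x pv).
Local Notation s1 := (x s1).
Local Notation s2 := (x s2).
Local Notation s3 := (x s3).
Local Notation t1 := (x (Pi_base t1)).
Local Notation t2 := (x (Pi_base t2)).
Local Notation L123 := (x (Pi_base (base_L L123))).
Local Notation L124 := (x (Pi_base (base_L L124))).
Local Notation L125 := (x (Pi_base (base_L L125))).
Local Notation L126 := (x (Pi_base (base_L L126))).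
Local Notation L135 := (x (Pi_base (base_L L135))).
Local Notation L136 := (x (Pi_base (base_L L136))).
Local Notation L245 := (x (Pi_base (base_L L245))).
Local Notation L246 := (x (Pi_base (base_L L246))).

Definition Delta : R := p1 * p4 - p2 * p3.
Definition lam (X Y Z : R) : R := L136 * X + L245 * Y + L246 * Z.
Definition mu (X Y Z : R) : R := L135 * X + L136 * Y + L245 * Z.

Definition U1 : R := p1 ^+ 2 + t1 * p2 ^+ 2 + p2 * u.
Definition U2 : R := 2 * p1 * p3 + 2 * t1 * p2 * p4 + p4 * u + p2 * v.
Definition U3 : R := p3 ^+ 2 + t1 * p4 ^+ 2 + p4 * v.

Definition I1 : R := t2 * p2 ^+ 2 + p1 * u.
Definition I2 : R := 2 * t2 * p2 * p4 + p3 * u + p1 * v.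
Definition I3 : R := t2 * p4 ^+ 2 + p3 * v.

Definition W1 : R := t1 * p2 * u - t2 * p1 * p2 + u ^+ 2.
Definition W2 : R :=
  t1 * (p4 * u + p2 * v) - t2 * (p2 * p3 + p1 * p4) + 2 * u * v.
Definition W3 : R := t1 * p4 * v - t2 * p3 * p4 + v ^+ 2.

Definition kappa1 : R := L135 * L245 - L136 ^+ 2.
Definition kappa2 : R := L135 * L246 - L136 * L245.
Definition kappa3 : R := L136 * L246 - L245 ^+ 2.

Definition F1 : R :=
  u * s1 - p1 * s2 - p2 * s3 - L126 * Delta - lam U1 U2 U3.

Definition F2 : R :=
  v * s1 - p3 * s2 - p4 * s3 + L125 * Delta + mu U1 U2 U3.

Definition F3 : R :=
  - t2 * p2 * s1 + (u + t1 * p2) * s2 - p1 * s3 - L124 * Delta - lam I1 I2 I3.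

Definition F4 : R :=
  - t2 * p4 * s1 + (v + t1 * p4) * s2 - p3 * s3 + L123 * Delta + mu I1 I2 I3.

Definition F5 : R :=
  - t2 * p1 * s1 + (t1 * p1 - t2 * p2) * s2 + (u + t1 * p2) * s3
  + L123 * U1 + L124 * (p1 * p3 + t1 * p2 * p4 + p2 * v)
  - L125 * I1 - L126 * (t2 * p2 * p4 + p1 * v) - lam W1 W2 W3.

Definition F6 : R :=
  - t2 * p3 * s1 + (t1 * p3 - t2 * p4) * s2 + (v + t1 * p4) * s3
  + L123 * (p1 * p3 + t1 * p2 * p4 + p4 * u) + L124 * U3
  - L125 * (t2 * p2 * p4 + p3 * u) - L126 * I3 + mu W1 W2 W3.

Definition F7 : R :=
  - s2 ^+ 2 + s1 * s3 + (L123 * p2 + L124 * p4) * s1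
  - (L125 * p2 + L126 * p4) * s2
  + L123 * lam (p2 ^+ 2) (2 * p2 * p4) (p4 ^+ 2)
  - L124 * mu (p2 ^+ 2) (2 * p2 * p4) (p4 ^+ 2)
  - L125 * lam (p1 * p2) (p2 * p3 + p1 * p4) (p3 * p4)
  + L126 * mu (p1 * p2) (p2 * p3 + p1 * p4) (p3 * p4)
  + kappa1 * (- p1 ^+ 2 + 2 * u * p2 + t1 * p2 ^+ 2)
  + kappa2 * (- p1 * p3 + u * p4 + v * p2 + t1 * p2 * p4)
  + kappa3 * (- p3 ^+ 2 + 2 * v * p4 + t1 * p4 ^+ 2).

Definition F8 : R :=
  s2 * s3 + t1 * s1 * s2 - t2 * s1 ^+ 2
  + s1 * (L123 * p1 + L124 * p3) - s2 * (L125 * p1 + L126 * p3)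
  + L123 * lam (p1 * p2) (p1 * p4 + p2 * p3) (p3 * p4)
  - L124 * mu (p1 * p2) (p1 * p4 + p2 * p3) (p3 * p4)
  - L125 * lam (p1 ^+ 2) (2 * p1 * p3) (p3 ^+ 2)
  + L126 * mu (p1 ^+ 2) (2 * p1 * p3) (p3 ^+ 2)
  + kappa1 * (2 * u * p1 + 2 * t1 * p1 * p2 - t2 * p2 ^+ 2)
  + kappa2 * (v * p1 + u * p3 + t1 * (p1 * p4 + p2 * p3) - t2 * p2 * p4)
  + kappa3 * (2 * v * p3 + 2 * t1 * p3 * p4 - t2 * p4 ^+ 2).

Definition F9 : R :=
  t1 * s2 ^+ 2 + s3 ^+ 2 - t2 * s1 * s2
  + s1 * (L123 * u + L124 * v) - s2 * (L125 * u + L126 * v)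
  + (L124 * L125 - L123 * L126) * Delta
  - L123 * lam (p1 ^+ 2 + t1 * p2 ^+ 2) (2 * p1 * p3 + 2 * t1 * p2 * p4)
               (p3 ^+ 2 + t1 * p4 ^+ 2)
  + L124 * mu (p1 ^+ 2 + t1 * p2 ^+ 2) (2 * p1 * p3 + 2 * t1 * p2 * p4)
              (p3 ^+ 2 + t1 * p4 ^+ 2)
  + t2 * L125 * lam (p2 ^+ 2) (2 * p2 * p4) (p4 ^+ 2)
  - t2 * L126 * mu (p2 ^+ 2) (2 * p2 * p4) (p4 ^+ 2)
  + kappa1 * (u ^+ 2 + 2 * t2 * p1 * p2)
  + kappa2 * (u * v + t2 * (p2 * p3 + p1 * p4))
  + kappa3 * (v ^+ 2 + 2 * t2 * p3 * p4).

Definition Pi_equations : Prop :=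
  [/\ F1 = 0, F2 = 0 & F3 = 0] /\
  [/\ F4 = 0, F5 = 0 & F6 = 0] /\
  [/\ F7 = 0, F8 = 0 & F9 = 0].

End PiEquations.

Section PiNaturality.
Variables (K : comNzRingType) (R S : comAlgType K) (f : {lrmorphism R -> S}).
Variable x : Pi_coord -> R.

Local Ltac unfold_ring :=
  rewrite /F1 /F2 /F3 /F4 /F5 /F6 /F7 /F8 /F9 /lam /mu /kappa1 /kappa2 /kappa3
    /U1 /U2 /U3 /I1 /I2 /I3 /W1 /W2 /W3 /Delta /=; ring.

Lemma F1_natural : F1 (f \o x) = f (F1 x). Proof. unfold_ring. Qed.
Lemma F2_natural : F2 (f \o x) = f (F2 x). Proof. unfold_ring. Qed.
Lemma F3_natural : F3 (f \o x) = f (F3 x). Proof. unfold_ring. Qed.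
Lemma F4_natural : F4 (f \o x) = f (F4 x). Proof. unfold_ring. Qed.
Lemma F5_natural : F5 (f \o x) = f (F5 x). Proof. unfold_ring. Qed.
Lemma F6_natural : F6 (f \o x) = f (F6 x). Proof. unfold_ring. Qed.
Lemma F7_natural : F7 (f \o x) = f (F7 x). Proof. unfold_ring. Qed.
Lemma F8_natural : F8 (f \o x) = f (F8 x). Proof. unfold_ring. Qed.
Lemma F9_natural : F9 (f \o x) = f (F9 x). Proof. unfold_ring. Qed.

Lemma Pi_stable : Pi_equations x -> Pi_equations (f \o x).
Proof.
move=> [[e1 e2 e3] [[e4 e5 e6] [e7 e8 e9]]].
rewrite /Pi_equations F1_natural F2_natural F3_natural F4_natural F5_natural.
rewrite F6_natural F7_natural F8_natural F9_natural.
by rewrite e1 e2 e3 e4 e5 e6 e7 e8 e9 rmorph0.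
Qed.

End PiNaturality.

Definition Pi15 (K : comNzRingType) : functor K :=
  subfunctor (X := affine_space K Pi_coord)
    (P := fun R x => Pi_equations x) (@Pi_stable K).

Program Definition Pi15_to_base (K : comNzRingType) :
    morphism (Pi15 K) (affine_space K base_coord) :=
  Morphism (mapp := fun R x => fun c => sval x (Pi_base c)) _.

Definition base_tilde (K : comNzRingType) : functor K :=
  product (affine_space K AB_coord) (affine_space K L_coord).

Program Definition b_morphism (K : comNzRingType) :
    morphism (base_tilde K) (affine_space K base_coord) :=
  Morphism (mapp := fun R z => fun c =>
    let A := z.1 cA in let B := z.1 cB in
    match c with
    | t1 => - A ^+ 2 - A * B - B ^+ 2
    | t2 => - A * B * (A + B)
    | base_L l => z.2 l
    end) _.
Next Obligation.
move=> K R S f z; apply/funext => -[||l] //=.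
all: ring.
Qed.

Definition Pi15_tilde (K : comNzRingType) : functor K :=
  fibre_product (Pi15_to_base K) (b_morphism K).

Definition p_Pi (K : comNzRingType) : morphism (Pi15_tilde K) (base_tilde K) :=
  fibre_proj2 (Pi15_to_base K) (b_morphism K).

Program Definition AB_disc (K : comNzRingType) :
    morphism (affine_space K AB_coord) (affine_line K) :=
  Morphism (mapp := fun R ab =>
    let A := ab cA in let B := ab cB in
    (A - B) * (2 * A + B) * (A + 2 * B)) _.
Next Obligation.
by move=> K R S f ab /=; ring.
Qed.

Definition U_AB (K : comNzRingType) : functor K := basic_open (AB_disc K).

Definition Pi15_tilde_AB (K : comNzRingType) :
    morphism (Pi15_tilde K) (affine_space K AB_coord) :=
  comp_morphism (proj1 _ _) (p_Pi K).

Definition Pi15_tilde_open (K : comNzRingType) : functor K :=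
  basic_open (comp_morphism (AB_disc K) (Pi15_tilde_AB K)).

Definition p_Pi_open (K : comNzRingType) :
    morphism (Pi15_tilde_open K) (product (U_AB K) (affine_space K L_coord)) :=
  pairing
    (open_restriction (Pi15_tilde_AB K) (AB_disc K))
    (comp_morphism (comp_morphism (proj2 _ _) (p_Pi K))
       (open_inclusion (comp_morphism (AB_disc K) (Pi15_tilde_AB K)))).

Definition mx2 (T : pzRingType) (a b c d : T) : 'M[T]_2 :=
  \matrix_(i < 2, j < 2)
    if i == 0 then (if j == 0 then a else b) else (if j == 0 then c else d).

Section HEquations.
Variables (K : comNzRingType) (R : comAlgType K) (y : H_coord -> R).

Definition xcoord (a : 'I_2) (i : 'I_3) : R := y (Hx a i).
Definition xvec (i : 'I_3) : 'cV[R]_2 := \col_a xcoord a i.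
Definition pcoord (i j k : 'I_2) : R := y (Hp (cp i j k)).
Definition ucoord (i : 'I_3) : R := y (Hu i).

Definition D1 (j k : 'I_2) : R :=
  \det (mx2 (pcoord 0 j k) (xcoord 0 0) (pcoord 1 j k) (xcoord 1 0)).
Definition D2 (j k : 'I_2) : R :=
  \det (mx2 (pcoord j 0 k) (xcoord 0 1) (pcoord j 1 k) (xcoord 1 1)).
Definition D3 (j k : 'I_2) : R :=
  \det (mx2 (pcoord j k 0) (xcoord 0 2) (pcoord j k 1) (xcoord 1 2)).

Definition H_equations : Prop :=
  [/\ ucoord 0 *: xvec 0
        = mx2 (- D3 0 1) (D3 0 0) (- D3 1 1) (D3 1 0) *m xvec 1,
      ucoord 1 *: xvec 1
        = mx2 (- D1 0 1) (D1 0 0) (- D1 1 1) (D1 1 0) *m xvec 2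
    & ucoord 2 *: xvec 2
        = mx2 (- D2 1 0) (D2 0 0) (- D2 1 1) (D2 0 1) *m xvec 0] /\
  [/\ ucoord 0 * ucoord 1 = D3 0 1 * D3 1 0 - D3 0 0 * D3 1 1,
      ucoord 1 * ucoord 2 = D1 0 1 * D1 1 0 - D1 0 0 * D1 1 1
    & ucoord 2 * ucoord 0 = D2 0 1 * D2 1 0 - D2 0 0 * D2 1 1].

End HEquations.

Lemma map_mx2 (R S : pzRingType) (f : {rmorphism R -> S}) (a b c d : R) :
  map_mx f (mx2 a b c d) = mx2 (f a) (f b) (f c) (f d).
Proof. by apply/matrixP => i j; rewrite !mxE; do 2!case: ifP. Qed.

Lemma H_stable (K : comNzRingType) (R S : comAlgType K)
    (f : {lrmorphism R -> S}) (y : affine_space K H_coord R) :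
  H_equations y -> H_equations (fmap (affine_space K H_coord) f y).
Proof.
have fx i : xvec (f \o y) i = map_mx f (xvec y i).
  by apply/matrixP => a c; rewrite !mxE.
have f1 j k : D1 (f \o y) j k = f (D1 y j k) by rewrite -det_map_mx map_mx2.
have f2 j k : D2 (f \o y) j k = f (D2 y j k) by rewrite -det_map_mx map_mx2.
have f3 j k : D3 (f \o y) j k = f (D3 y j k) by rewrite -det_map_mx map_mx2.
have fu i : ucoord (f \o y) i = f (ucoord y i) by [].
case=> -[e1 e2 e3] [e4 e5 e6]; do !split;
  rewrite /= ?fx ?f1 ?f2 ?f3 !fu -?rmorphN -?map_mxZ -?map_mx2 -?map_mxM
    -?rmorphM ?(e1, e2, e3, e4, e5, e6) // ?rmorphB //.
Qed.

Definition H13 (K : comNzRingType) : functor K :=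
  subfunctor (X := affine_space K H_coord)
    (P := fun R y => H_equations y) (@H_stable K).

Program Definition p_H (K : comNzRingType) :
    morphism (H13 K) (affine_space K P_coord) :=
  Morphism (mapp := fun R y => fun c => sval y (Hp c)) _.

(* Main.v *)
(* The cubic t^3 + t1 t - t2 has the roots A, B, C = - A - B, and the open set
   U_AB is where they are distinct.  Evaluating at the roots r the polynomials
   u - p1 r - p2 r^2, v - p3 r - p4 r^2 and (r^2 + t1) s1 + r s2 + s3 turns
   (p1, p2, u), (p3, p4, v) and (s1, s2, s3) into xi_r, eta_r and sigma_r, and
   the vectors x_1, x_2, x_3 of H are (xi_r, eta_r) for r = A, B, C.  The same
   combinations of F1, F3, F5 (and of F2, F4, F6) read: disc * sigma_r * xi_r
   equals a bilinear form in the vectors at the other two roots, up to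
   multiples of xi_r that are absorbed in u_i, a translate of disc * sigma_r.
   The coefficients of this form are the p_ijk: the L136, L245, ... give the
   symmetric part of the cube and (L123, L124), (L125, L126) the rest.
   Likewise F9 - r F8 - r^2 F7 gives the equation for the product of the u_i at
   the other two roots, modulo the previous equations.  Lagrange interpolation
   at the roots, and division by 3, invert these substitutions. *)

Require Import Defs.
From mathcomp Require Import all_boot all_order all_algebra.
From mathcomp Require Import boolp reals.
From mathcomp Require Import complex.
From mathcomp Require Import ring.

Set Implicit Arguments.
Unset Strict Implicit.
Unset Printing Implicit Defensive.

Import GRing.Theory.
Local Open Scope ring_scope.

(** * Morphisms of functors of points and small index types *)

(** Injectivity of [f] forces the pointwise chosen inverse to be natural. Hence the explicit
    inverses below, which depend on a choice of the inverse [w] of the discriminant, never need a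
    naturality proof. *)
Lemma bijective_isomorphism (K : comNzRingType) (X Y : functor K)
    (f : morphism X Y) :
  (forall R : comAlgType K, injective (mapp f (R := R))) ->
  (forall (R : comAlgType K) (y : Y R), exists x, f R x = y) ->
  is_isomorphism f.
Proof.
move=> finj fsurj.
pose g R y := sval (cid (fsurj R y)).
have gK R y : f R (g R y) = y by rewrite /g; case: (cid _).
have gnat (R S : comAlgType K) (h : {lrmorphism R -> S}) y :
    g S (fmap Y h y) = fmap X h (g R y).
  by apply: finj; rewrite natural !gK.
by exists (Morphism gnat); split=> R x /=; [apply: finj|]; rewrite gK.
Qed.

Lemma and_iff (P Q P' Q' : Prop) :
  (P <-> P') -> (Q <-> Q') -> (P /\ Q <-> P' /\ Q').
Proof. by move=> [? ?] [? ?]; split=> -[? ?]; split; auto. Qed.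

Lemma ord2_cases (i : 'I_2) : i = 0 \/ i = 1.
Proof. by case: i => [[|[|//]] lti]; [left|right]; apply: val_inj. Qed.

Lemma ord3_cases (i : 'I_3) : [\/ i = 0, i = 1 | i = 2].
Proof.
by case: i => [[|[|[|//]]] lti]; [constructor 1|constructor 2|constructor 3];
  apply: val_inj.
Qed.

(** * Coordinates and equations at the roots of the cubic *)

Section Coordinates.
Variables (K : comNzRingType) (R : comAlgType K).
Implicit Types (r A B C : R) (x : Pi_coord -> R) (L : L_coord -> R).

(* Below r, r', r'' are the roots A, B, - A - B of t^3 + t1 t - t2 up to cyclic
   rotation, which, unlike a transposition, fixes [disc3]. *)
Definition disc3 r r' r'' : R := (r - r') * (r - r'') * (r' - r'').

Lemma disc3_rot r r' r'' : disc3 r' r'' r = disc3 r r' r''.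
Proof. by rewrite /disc3; ring. Qed.

Definition xi x r : R := x pu - r * x p1 - r ^+ 2 * x p2.
Definition eta x r : R := x pv - r * x p3 - r ^+ 2 * x p4.
Definition sigma x r : R :=
  (r ^+ 2 + x (Pi_base t1)) * x s1 + r * x s2 + x s3.

Definition Lcoords x : L_coord -> R := fun l => x (Pi_base (base_L l)).

Definition acoef L r r' r'' : R := (r' - r'') * (L L123 - r * L L125).
Definition bcoef L r r' r'' : R := (r' - r'') * (L L124 - r * L L126).

Definition ushift L r r' r'' (a' b' a'' b'' : R) : R :=
  acoef L r'' r r' * a' + bcoef L r'' r r' * b'
  + acoef L r' r'' r * a'' + bcoef L r' r'' r * b''.

Definition ucoef x r r' r'' : R :=
  disc3 r r' r'' * sigma x r
  + ushift (Lcoords x) r r' r'' (xi x r') (eta x r') (xi x r'') (eta x r'').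

Definition cube_a L r r' r'' : R := disc3 r r' r'' * L L136 - acoef L r r' r''.
Definition cube_b L r r' r'' : R :=
  - (disc3 r r' r'' * L L245) - bcoef L r r' r''.

Definition Fxi x r : R := (r ^+ 2 + x (Pi_base t1)) * F1 x + r * F3 x + F5 x.
Definition Feta x r : R := (r ^+ 2 + x (Pi_base t1)) * F2 x + r * F4 x + F6 x.
Definition Fsigma x r : R := F9 x - r * F8 x - r ^+ 2 * F7 x.

Section Identities.
Variables (x : Pi_coord -> R) (r r' r'' : R).
Hypothesis rE : r = - r' - r''.
Hypothesis t1E : x (Pi_base t1) = - r' ^+ 2 - r' * r'' - r'' ^+ 2.
Hypothesis t2E : x (Pi_base t2) = - r' * r'' * (r' + r'').
Let L := Lcoords x.
Let D := disc3 r r' r''.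

Local Ltac unfold_ring :=
  rewrite /D /L /Fxi /Feta /Fsigma /ucoef /ushift /cube_a /cube_b /acoef
    /bcoef /disc3 /xi /eta /sigma /Lcoords
    /F1 /F2 /F3 /F4 /F5 /F6 /F7 /F8 /F9 /lam /mu /kappa1 /kappa2 /kappa3
    /U1 /U2 /U3 /I1 /I2 /I3 /W1 /W2 /W3 /Delta t1E t2E rE; ring.

(** Eliminating [r], [t1] and [t2] by Vieta's formulas leaves a polynomial identity. The bracket is
    the right-hand side of the equation of H for the u at the root [r]; the same shift in [ucoef]
    serves for [ucoef_eta]. *)
Lemma ucoef_xi :
  ucoef x r r' r'' * xi x r
  - (D * L L246 * eta x r' * eta x r''
     - cube_b L r'' r r' * eta x r' * xi x r''
     - cube_b L r' r'' r * xi x r' * eta x r''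
     + cube_a L r r' r'' * xi x r' * xi x r'') = D * Fxi x r.
Proof. unfold_ring. Qed.

Lemma ucoef_eta :
  ucoef x r r' r'' * eta x r
  - (cube_b L r r' r'' * eta x r' * eta x r''
     - cube_a L r' r'' r * eta x r' * xi x r''
     - cube_a L r'' r r' * xi x r' * eta x r''
     - D * L L135 * xi x r' * xi x r'') = D * Feta x r.
Proof. unfold_ring. Qed.

(** The four [ctr] are the determinants [D1], [D2], [D3] contracting the cube with the vector at
    [r], with 01 and 10 exchanged for [D2]; only the product of these two enters below. *)
Definition ctr00 := D * L L246 * eta x r - cube_b L r r' r'' * xi x r.
Definition ctr01 := cube_b L r'' r r' * eta x r - cube_a L r' r'' r * xi x r.
Definition ctr10 := cube_b L r' r'' r * eta x r - cube_a L r'' r r' * xi x r.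
Definition ctr11 := cube_a L r r' r'' * eta x r + D * L L135 * xi x r.

Lemma ucoef_ucoef :
  ucoef x r' r'' r * ucoef x r'' r r' - (ctr01 * ctr10 - ctr00 * ctr11)
  = D ^+ 2 * Fsigma x r
    + D * (acoef L r r' r'' * (Fxi x r' + Fxi x r'' - Fxi x r)
           + bcoef L r r' r'' * (Feta x r' + Feta x r'' - Feta x r)).
Proof. rewrite /ctr00 /ctr01 /ctr10 /ctr11. unfold_ring. Qed.
End Identities.

Section Roots.
Variables A B : R.
Local Notation C := (- A - B).
Local Notation D := (disc3 A B C).

Definition pick2 (a b : R) (i : 'I_2) : R := if i == 0 then a else b.
Definition pick3 (a b c : R) (i : 'I_3) : R :=
  if i == 0 then a else if i == 1 then b else c.

(** The three index positions correspond to the roots A, B, C. In a mixed entry the position whose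
    index differs from the other two selects the root: [cube_b] if that index is 1, [cube_a] if it
    is 0. *)
Definition cube L (c : P_coord) : R :=
  let: cp i j k := c in
  pick2
    (pick2 (pick2 (D * L L246) (cube_b L C A B) k)
           (pick2 (cube_b L B C A) (cube_a L A B C) k) j)
    (pick2 (pick2 (cube_b L A B C) (cube_a L B C A) k)
           (pick2 (cube_a L C A B) (- (D * L L135)) k) j) i.

Definition H_of_Pi x (c : H_coord) : R :=
  match c with
  | Hx a i => pick2 (pick3 (xi x A) (xi x B) (xi x C) i)
                    (pick3 (eta x A) (eta x B) (eta x C) i) a
  | Hp c => cube (Lcoords x) c
  | Hu i => pick3 (ucoef x A B C) (ucoef x B C A) (ucoef x C A B) i
  end.

Definition on_base x : Prop :=
  x (Pi_base t1) = - A ^+ 2 - A * B - B ^+ 2 /\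
  x (Pi_base t2) = - A * B * (A + B).

End Roots.

(** * The equations of H in scalar form *)

Lemma sub_eq0_iff (a b d : R) : a - b = d -> (a = b <-> d = 0).
Proof. by move=> <-; split=> [->|/subr0_eq //]; rewrite subrr. Qed.

Lemma colP_iff (u v : 'cV[R]_2) : u = v <-> u 0 0 = v 0 0 /\ u 1 0 = v 1 0.
Proof.
split=> [->//|[e0 e1]]; apply/colP => i.
by case: i => [[|[|//]] lti]; [move: e0 | move: e1]; congr (u _ _ = v _ _);
  apply: val_inj.
Qed.

Lemma det_mx2 (a b c d : R) : \det (mx2 a b c d) = a * d - b * c.
Proof.
rewrite (expand_det_row _ 0) !big_ord_recl big_ord0 /cofactor !det_mx11 !mxE /=.
by rewrite expr0 expr1 mul1r addr0 mulN1r mulrN.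
Qed.

Lemma mx2_mulE (a b c d : R) (u : 'cV[R]_2) :
  (mx2 a b c d *m u) 0 0 = a * u 0 0 + b * u 1 0 /\
  (mx2 a b c d *m u) 1 0 = c * u 0 0 + d * u 1 0.
Proof.
by rewrite !mxE !big_ord_recl !big_ord0 !mxE /= !addr0;
  split; congr (_ + _ * u _ _); apply: val_inj.
Qed.

Lemma H_equationsE (y : H_coord -> R) :
  let X a i := y (Hx a i) in
  let U i := y (Hu i) in
  let d1 j k := D1 y j k in let d2 j k := D2 y j k in let d3 j k := D3 y j k in
  H_equations y <->
  ((U 0 * X 0 0 = - d3 0 1 * X 0 1 + d3 0 0 * X 1 1 /\
    U 0 * X 1 0 = - d3 1 1 * X 0 1 + d3 1 0 * X 1 1) /\
   (U 1 * X 0 1 = - d1 0 1 * X 0 2 + d1 0 0 * X 1 2 /\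
    U 1 * X 1 1 = - d1 1 1 * X 0 2 + d1 1 0 * X 1 2) /\
   (U 2 * X 0 2 = - d2 1 0 * X 0 0 + d2 0 0 * X 1 0 /\
    U 2 * X 1 2 = - d2 1 1 * X 0 0 + d2 0 1 * X 1 0)) /\
  (U 0 * U 1 = d3 0 1 * d3 1 0 - d3 0 0 * d3 1 1 /\
   U 1 * U 2 = d1 0 1 * d1 1 0 - d1 0 0 * d1 1 1 /\
   U 2 * U 0 = d2 0 1 * d2 1 0 - d2 0 0 * d2 1 1).
Proof.
move=> X U d1 d2 d3.
have vecE i j a b c d :
    U i *: xvec y i = mx2 a b c d *m xvec y j <->
    U i * X 0 i = a * X 0 j + b * X 1 j /\ U i * X 1 i = c * X 0 j + d * X 1 j.
  rewrite colP_iff; have [-> ->] := mx2_mulE a b c d (xvec y j).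
  by rewrite !mxE.
split.
- by case=> -[/vecE ? /vecE ? /vecE ?] [].
- by case=> -[/vecE ? [/vecE ? /vecE ?]] [? []].
Qed.

(** * Equivalence of the two systems of equations *)

Section Spectral.
Variables (A B : R) (x : Pi_coord -> R).
Hypothesis xAB : on_base A B x.
Local Notation C := (- A - B).
Local Notation D := (disc3 A B C).
Let L := Lcoords x.

Definition Fuu r r' r'' : R :=
  D ^+ 2 * Fsigma x r
  + D * (acoef L r r' r'' * (Fxi x r' + Fxi x r'' - Fxi x r)
         + bcoef L r r' r'' * (Feta x r' + Feta x r'' - Feta x r)).

(** The identities above are specialised at the three rotations of (A, B, C). The quadratic
    equations start with C because the product of the u at A and B is expressed by [D3], the
    contraction with the vector at C. *)
Lemma H_of_Pi_equations :
  H_equations (H_of_Pi A B x) <->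
  ((D * Fxi x A = 0 /\ D * Feta x A = 0) /\
   (D * Fxi x B = 0 /\ D * Feta x B = 0) /\
   (D * Fxi x C = 0 /\ D * Feta x C = 0)) /\
  (Fuu C A B = 0 /\ Fuu A B C = 0 /\ Fuu B C A = 0).
Proof.
have [T1 T2] := xAB.
have A_BC : A = - B - C by ring.
have B_CA : B = - C - A by ring.
have T1A : x (Pi_base t1) = - B ^+ 2 - B * C - C ^+ 2 by rewrite T1; ring.
have T2A : x (Pi_base t2) = - B * C * (B + C) by rewrite T2; ring.
have T1B : x (Pi_base t1) = - C ^+ 2 - C * A - A ^+ 2 by rewrite T1; ring.
have T2B : x (Pi_base t2) = - C * A * (C + A) by rewrite T2; ring.
have DB : disc3 B C A = D by rewrite disc3_rot.
have DC : disc3 C A B = D by rewrite -disc3_rot.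
have xiA := ucoef_xi A_BC T1A T2A; have etaA := ucoef_eta A_BC T1A T2A.
have xiB := ucoef_xi B_CA T1B T2B; have etaB := ucoef_eta B_CA T1B T2B.
have xiC := ucoef_xi (erefl C) T1 T2; have etaC := ucoef_eta (erefl C) T1 T2.
have uuA := ucoef_ucoef A_BC T1A T2A; have uuB := ucoef_ucoef B_CA T1B T2B.
have uuC := ucoef_ucoef (erefl C) T1 T2.
rewrite /ctr00 /ctr01 /ctr10 /ctr11 ?DB ?DC in xiB etaB xiC etaC uuA uuB uuC.
rewrite H_equationsE /D1 /D2 /D3 !det_mx2 /xcoord /pcoord /= /pick2 /pick3 /=.
rewrite /Fuu.
do !apply: and_iff; apply: sub_eq0_iff.
- by rewrite -xiA; ring.
- by rewrite -etaA; ring.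
- by rewrite -xiB; ring.
- by rewrite -etaB; ring.
- by rewrite -xiC; ring.
- by rewrite -etaC; ring.
- by rewrite -uuC; ring.
- by rewrite -uuA; ring.
- by rewrite -uuB; ring.
Qed.

Variable w : R.
Hypothesis wD : w * D = 1.

Lemma mulD_eq0 a : D * a = 0 -> a = 0.
Proof. by move=> Da0; rewrite -[a]mul1r -wD -mulrA Da0 mulr0. Qed.

(** The weights [B - C], [C - A], [A - B] sum to 0 against 1 and r, and to [D] against r^2. They
    isolate [D * a], and after multiplication by the roots [D * b]. *)
Lemma sigma_lagrange a b c :
  let m r := (r ^+ 2 + x (Pi_base t1)) * a + r * b + c in
  m A = 0 -> m B = 0 -> m C = 0 -> [/\ a = 0, b = 0 & c = 0].
Proof.
have [T1 T2] := xAB; move=> m mA mB mC.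
have sum0 k : (B - C) * A ^+ k * m A + (C - A) * B ^+ k * m B
              + (A - B) * C ^+ k * m C = 0.
  by rewrite mA mB mC !mulr0 !addr0.
have a0 : a = 0.
  by apply: mulD_eq0; rewrite -[RHS](sum0 0%N) /m T1 /disc3; ring.
have b0 : b = 0.
  by apply: mulD_eq0; rewrite -[RHS](sum0 1%N) /m T1 /disc3 a0; ring.
by split=> //; move: mA; rewrite /m a0 b0 !mulr0 !add0r.
Qed.

Lemma xi_lagrange a b c :
  let m r := c - r * b - r ^+ 2 * a in
  m A = 0 -> m B = 0 -> m C = 0 -> [/\ a = 0, b = 0 & c = 0].
Proof.
move=> m; pose m' r := (r ^+ 2 + x (Pi_base t1)) * a + r * b
  + (- (x (Pi_base t1)) * a - c).
have mm r : m' r = - m r by rewrite /m' /m; ring.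
move=> mA mB mC; have [] := @sigma_lagrange a b (- (x (Pi_base t1)) * a - c).
- by rewrite -/(m' A) mm mA oppr0.
- by rewrite -/(m' B) mm mB oppr0.
- by rewrite -/(m' C) mm mC oppr0.
by move=> -> ->; rewrite mulr0 add0r => /eqP; rewrite oppr_eq0 => /eqP ->.
Qed.

Lemma H_of_Pi_iff : Pi_equations x <-> H_equations (H_of_Pi A B x).
Proof.
rewrite H_of_Pi_equations; split.
  move=> [[f1 f2 f3] [[f4 f5 f6] [f7 f8 f9]]].
  have gx r : Fxi x r = 0 by rewrite /Fxi f1 f3 f5; ring.
  have ge r : Feta x r = 0 by rewrite /Feta f2 f4 f6; ring.
  have gs r : Fsigma x r = 0 by rewrite /Fsigma f7 f8 f9; ring.
  by rewrite /Fuu !gx !ge !gs !(mulr0, addr0, subr0).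
move=> [[[/mulD_eq0 xA /mulD_eq0 eA] [[/mulD_eq0 xB /mulD_eq0 eB]
        [/mulD_eq0 xC /mulD_eq0 eC]]] uu]; move: uu.
(* Once [Fxi] and [Feta] vanish at the three roots, [Fuu] reduces to [D ^+ 2 * Fsigma]. *)
have D2_eq0 a : D ^+ 2 * a = 0 -> a = 0.
  by rewrite expr2 -mulrA => /mulD_eq0/mulD_eq0.
rewrite /Fuu xA eA xB eB xC eC !(mulr0, addr0, subr0).
move=> [/D2_eq0 sC [/D2_eq0 sA /D2_eq0 sB]].
have [f1 f3 f5] := sigma_lagrange xA xB xC.
have [f2 f4 f6] := sigma_lagrange eA eB eC.
have [f7 f8 f9] := xi_lagrange sA sB sC.
by [].
Qed.

End Spectral.

(** * The inverse substitution *)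

Section Inverse.
Variables (w th A B : R).
Local Notation C := (- A - B).
Local Notation D := (disc3 A B C).
Hypotheses (wD : w * D = 1) (th3 : 3 * th = 1).

(** [a k] and [b k] are moments of the mixed entries at the roots. The power sums of the roots are
    3, 0, [q], and the cyclic sums of [(B - C) * A ^+ k] for k = 0, 1, 2, 3 are 0, 0, [D], 0. So on
    a cube built from L the moments [a 0], [a 1], [a 2] are [3 * D * L136], [D * L125],
    [D * (q * L136 - L123)], and similarly for [b]. *)
Definition cube_inv (P : P_coord -> R) (l : L_coord) : R :=
  let p i j k := P (cp i j k) in
  let a k := A ^+ k * p 0 1 1 + B ^+ k * p 1 0 1 + C ^+ k * p 1 1 0 in
  let b k := A ^+ k * p 1 0 0 + B ^+ k * p 0 1 0 + C ^+ k * p 0 0 1 in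
  let q := A ^+ 2 + B ^+ 2 + C ^+ 2 in
  match l with
  | L123 => w * (th * a 0%N * q - a 2%N)
  | L124 => w * (th * b 0%N * q - b 2%N)
  | L125 => w * a 1%N
  | L126 => w * b 1%N
  | L135 => - (w * p 1 1 1)
  | L136 => w * th * a 0%N
  | L245 => - (w * th * b 0%N)
  | L246 => w * p 0 0 0
  end.

(* Membership in the ideal of the relations [wD] and [th3] is given to [ring]
   by explicit cofactors. *)
Lemma eqD_cofactors (a b c d : R) :
  a = b + (w * D - 1) * c + (3 * th - 1) * d -> a = b.
Proof. by rewrite wD th3 subrr !mul0r !addr0. Qed.

Lemma cubeK : cancel (cube A B) cube_inv.
Proof.
move=> L; apply/funext.
have aE k : A ^+ k * cube_a L A B C + B ^+ k * cube_a L B C A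
    + C ^+ k * cube_a L C A B
    = D * L L136 * (A ^+ k + B ^+ k + C ^+ k)
      - L L123 * ((B - C) * A ^+ k + (C - A) * B ^+ k + (A - B) * C ^+ k)
      + L L125 * ((B - C) * A ^+ k.+1 + (C - A) * B ^+ k.+1
                  + (A - B) * C ^+ k.+1).
  by rewrite /cube_a /acoef /disc3 !exprS; ring.
have bE k : A ^+ k * cube_b L A B C + B ^+ k * cube_b L B C A
    + C ^+ k * cube_b L C A B
    = - D * L L245 * (A ^+ k + B ^+ k + C ^+ k)
      - L L124 * ((B - C) * A ^+ k + (C - A) * B ^+ k + (A - B) * C ^+ k)
      + L L126 * ((B - C) * A ^+ k.+1 + (C - A) * B ^+ k.+1
                  + (A - B) * C ^+ k.+1).
  by rewrite /cube_b /bcoef /disc3 !exprS; ring.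
pose q := A ^+ 2 + B ^+ 2 + C ^+ 2.
case; rewrite /cube_inv /cube /pick2 /= ?aE ?bE.
(* The left side is [w * D * L123 + (3 * th - 1) * w * D * q * L136], which gives both cofactors. *)
- apply: (eqD_cofactors (c := L L123) (d := w * D * q * L L136)).
  by rewrite /q /disc3; ring.
- apply: (eqD_cofactors (c := L L124) (d := - (w * D * q * L L245))).
  by rewrite /q /disc3; ring.
- by apply: (eqD_cofactors (c := L L125) (d := 0)); rewrite /disc3; ring.
- by apply: (eqD_cofactors (c := L L126) (d := 0)); rewrite /disc3; ring.
- by apply: (eqD_cofactors (c := L L135) (d := 0)); ring.
- by apply: (eqD_cofactors (c := L L136) (d := w * D * L L136));
    rewrite /disc3; ring.
- by apply: (eqD_cofactors (c := L L245) (d := w * D * L L245));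
    rewrite /disc3; ring.
- by apply: (eqD_cofactors (c := L L246) (d := 0)); ring.
Qed.

Lemma cube_invK : cancel cube_inv (cube A B).
Proof.
move=> P; apply/funext => -[i j k]; rewrite /cube.
pose p i j k := P (cp i j k).
pose a := p 0 1 1 + p 1 0 1 + p 1 1 0.
pose b := p 1 0 0 + p 0 1 0 + p 0 0 1.
case: (ord2_cases i) => ->; case: (ord2_cases j) => ->;
  case: (ord2_cases k) => ->;
  rewrite /pick2 /= /cube_a /cube_b /acoef /bcoef /=.
- by apply: (eqD_cofactors (c := p 0 0 0) (d := 0)); rewrite /p; ring.
(* From D = (A - B)(AB + 2C^2) and D - (A - B)(A^2 + B^2 + C^2) = 3AB(A - B), the entry equals [w *
   D * p 0 0 1 + (3 * th - 1) * w * (A - B) * A * B * b]. The other mixed entries follow the same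
   pattern, rotated, with [a] or [b]. *)
- apply: (eqD_cofactors (c := p 0 0 1) (d := w * (A - B) * A * B * b)).
  by rewrite /b /p /disc3; ring.
- apply: (eqD_cofactors (c := p 0 1 0) (d := w * (C - A) * C * A * b)).
  by rewrite /b /p /disc3; ring.
- apply: (eqD_cofactors (c := p 0 1 1) (d := w * (B - C) * B * C * a)).
  by rewrite /a /p /disc3; ring.
- apply: (eqD_cofactors (c := p 1 0 0) (d := w * (B - C) * B * C * b)).
  by rewrite /b /p /disc3; ring.
- apply: (eqD_cofactors (c := p 1 0 1) (d := w * (C - A) * C * A * a)).
  by rewrite /a /p /disc3; ring.
- apply: (eqD_cofactors (c := p 1 1 0) (d := w * (A - B) * A * B * a)).
  by rewrite /a /p /disc3; ring.
- by apply: (eqD_cofactors (c := p 1 1 1) (d := 0)); rewrite /p; ring.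
Qed.

Definition T1 : R := - A ^+ 2 - A * B - B ^+ 2.
Definition T2 : R := - A * B * (A + B).
Definition rt : 'I_3 -> R := pick3 A B C.

(* Divided differences at the roots invert evaluation at the roots. *)
Definition divdiff (f : 'I_3 -> R) : R :=
  w * ((B - C) * f 0 + (C - A) * f 1 + (A - B) * f 2).

(** [m i j k] undoes the shift and the factor [D] in [ucoef], giving back [sigma] at root i; the
    triples are cyclic so that the discriminant keeps its sign. *)
Definition Pi_of_H (y : H_coord -> R) (c : Pi_coord) : R :=
  let L := cube_inv (fun c => y (Hp c)) in
  let X i := y (Hx 0 i) in let Y i := y (Hx 1 i) in
  let m i j k := w * (y (Hu i)
    - ushift L (rt i) (rt j) (rt k) (X j) (Y j) (X k) (Y k)) in
  let S := pick3 (m 0 1 2) (m 1 2 0) (m 2 0 1) in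
  match c with
  | pu => divdiff (fun i => (rt i ^+ 2 + T1) * X i)
  | p1 => - divdiff (fun i => rt i * X i)
  | p2 => - divdiff X
  | pv => divdiff (fun i => (rt i ^+ 2 + T1) * Y i)
  | p3 => - divdiff (fun i => rt i * Y i)
  | p4 => - divdiff Y
  | s1 => divdiff S
  | s2 => divdiff (fun i => rt i * S i)
  | s3 => divdiff (fun i => rt i ^+ 2 * S i)
  | Pi_base t1 => T1
  | Pi_base t2 => T2
  | Pi_base (base_L l) => L l
  end.

(** [divdiff f] is the sum of f(r)/chi'(r) over the roots of chi = t^3 + t1 t - t2. For the pairing
    of f and g by [divdiff] of their product, the basis 1, r, r^2 is dual to r^2 + t1, r, 1; the two
    families of weights therefore trade places between evaluation and interpolation. *)
Lemma eval_divdiff (f : 'I_3 -> R) (i : 'I_3) :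
  divdiff (fun i => (rt i ^+ 2 + T1) * f i)
  - rt i * - divdiff (fun i => rt i * f i) - rt i ^+ 2 * - divdiff f = f i.
Proof.
by apply: (eqD_cofactors (c := f i) (d := 0)); case: (ord3_cases i) => ->;
  rewrite /divdiff /T1 /rt /pick3 /disc3 /=; ring.
Qed.

Lemma eval_divdiff_dual (f : 'I_3 -> R) (i : 'I_3) :
  (rt i ^+ 2 + T1) * divdiff f + rt i * divdiff (fun i => rt i * f i)
  + divdiff (fun i => rt i ^+ 2 * f i) = f i.
Proof.
by apply: (eqD_cofactors (c := f i) (d := 0)); case: (ord3_cases i) => ->;
  rewrite /divdiff /T1 /rt /pick3 /disc3 /=; ring.
Qed.

Lemma divdiff_eval (f : 'I_3 -> R) (a b c : R) :
  (forall i, f i = a - rt i * b - rt i ^+ 2 * c) ->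
  [/\ divdiff (fun i => (rt i ^+ 2 + T1) * f i) = a,
      - divdiff (fun i => rt i * f i) = b & - divdiff f = c].
Proof.
move=> fE; split; [ apply: (eqD_cofactors (c := a) (d := 0))
  | apply: (eqD_cofactors (c := b) (d := 0))
  | apply: (eqD_cofactors (c := c) (d := 0)) ];
  by rewrite /divdiff !fE /T1 /rt /pick3 /disc3 /=; ring.
Qed.

Lemma divdiff_eval_dual (f : 'I_3 -> R) (a b c : R) :
  (forall i, f i = (rt i ^+ 2 + T1) * a + rt i * b + c) ->
  [/\ divdiff f = a, divdiff (fun i => rt i * f i) = b
    & divdiff (fun i => rt i ^+ 2 * f i) = c].
Proof.
move=> fE; split; [ apply: (eqD_cofactors (c := a) (d := 0))
  | apply: (eqD_cofactors (c := b) (d := 0))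
  | apply: (eqD_cofactors (c := c) (d := 0)) ];
  by rewrite /divdiff !fE /T1 /rt /pick3 /disc3 /=; ring.
Qed.

Lemma Pi_of_H_on_base y : on_base A B (Pi_of_H y).
Proof. by []. Qed.

Lemma H_of_PiK x : on_base A B x -> Pi_of_H (H_of_Pi A B x) = x.
Proof.
move=> [T1x T2x]; set y := H_of_Pi A B x.
have LE : cube_inv (fun c => y (Hp c)) = Lcoords x by rewrite -[RHS]cubeK.
have XE i : y (Hx 0 i) = x pu - rt i * x p1 - rt i ^+ 2 * x p2.
  by case: (ord3_cases i) => ->.
have YE i : y (Hx 1 i) = x pv - rt i * x p3 - rt i ^+ 2 * x p4.
  by case: (ord3_cases i) => ->.
have [u_ p1_ p2_] := divdiff_eval XE.
have [v_ p3_ p4_] := divdiff_eval YE.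
pose m i j k := w * (y (Hu i)
  - ushift (Lcoords x) (rt i) (rt j) (rt k)
      (y (Hx 0 j)) (y (Hx 1 j)) (y (Hx 0 k)) (y (Hx 1 k))).
have SE i : pick3 (m 0 1 2) (m 1 2 0) (m 2 0 1) i
    = (rt i ^+ 2 + T1) * x s1 + rt i * x s2 + x s3.
  rewrite /T1 -T1x -/(sigma x (rt i)).
  have DB : disc3 B C A = D by rewrite disc3_rot.
  have DC : disc3 C A B = D by rewrite -disc3_rot.
  have wDK (z s : R) : w * (D * z + s - s) = z by rewrite addrK mulrA wD mul1r.
  by case: (ord3_cases i) => ->; rewrite /m /y /= /rt /pick3 /= /ucoef
    ?DB ?DC; apply: wDK.
have [s1_ s2_ s3_] := divdiff_eval_dual SE.
apply/funext => -[||||||||| [||l]]; rewrite /Pi_of_H ?LE //.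
Qed.

Lemma Pi_of_HK y : H_of_Pi A B (Pi_of_H y) = y.
Proof.
have LE : Lcoords (Pi_of_H y) = cube_inv (fun c => y (Hp c)) by [].
have XE i : xi (Pi_of_H y) (rt i) = y (Hx 0 i) by exact: eval_divdiff.
have YE i : eta (Pi_of_H y) (rt i) = y (Hx 1 i) by exact: eval_divdiff.
have XA : xi (Pi_of_H y) A = y (Hx 0 0) := XE 0.
have XB : xi (Pi_of_H y) B = y (Hx 0 1) := XE 1.
have XC : xi (Pi_of_H y) C = y (Hx 0 2) := XE 2.
have YA : eta (Pi_of_H y) A = y (Hx 1 0) := YE 0.
have YB : eta (Pi_of_H y) B = y (Hx 1 1) := YE 1.
have YC : eta (Pi_of_H y) C = y (Hx 1 2) := YE 2.
apply/funext => -[a i|c|i] /=.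
- case: (ord2_cases a) => ->; rewrite /pick2 /=.
    by case: (ord3_cases i) => ->; [exact: XA|exact: XB|exact: XC].
  by case: (ord3_cases i) => ->; [exact: YA|exact: YB|exact: YC].
- by rewrite LE cube_invK.
- have DB : disc3 B C A = D by rewrite disc3_rot.
  have DC : disc3 C A B = D by rewrite -disc3_rot.
  have DwK (t z s : R) : t = w * (z - s) -> D * t + s = z.
    by move=> ->; rewrite mulrA [D * w]mulrC wD mul1r subrK.
  case: (ord3_cases i) => ->;
    rewrite /pick3 /= /ucoef ?DB ?DC LE !(XA, XB, XC, YA, YB, YC); apply: DwK.
  + exact: (eval_divdiff_dual _ 0).
  + exact: (eval_divdiff_dual _ 1).
  + exact: (eval_divdiff_dual _ 2).
Qed.
End Inverse.
End Coordinates.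

(** * Compatibility with change of algebra *)

Section Naturality.
Variables (K : comNzRingType) (R S : comAlgType K) (f : {lrmorphism R -> S}).

Lemma cube_natural (A B : R) (L : L_coord -> R) :
  cube (f A) (f B) (f \o L) = f \o cube A B L.
Proof.
apply/funext => -[i j k].
case: (ord2_cases i) => ->; case: (ord2_cases j) => ->;
  case: (ord2_cases k) => ->;
  by rewrite /cube /pick2 /= /cube_a /cube_b /acoef /bcoef /disc3 /=; ring.
Qed.

Lemma H_of_Pi_natural (A B : R) (x : Pi_coord -> R) :
  H_of_Pi (f A) (f B) (f \o x) = f \o H_of_Pi A B x.
Proof.
apply/funext => -[a i|c|i] /=.
- by case: (ord2_cases a) => ->; case: (ord3_cases i) => ->;
    rewrite /pick2 /pick3 /xi /eta /=; ring.
- exact: (congr1 (fun P => P c) (cube_natural A B (Lcoords x))).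
- by case: (ord3_cases i) => ->;
    rewrite /pick3 /ucoef /ushift /sigma /acoef /bcoef /disc3 /xi /eta /Lcoords
      /=; ring.
Qed.

End Naturality.

(** * The two isomorphisms and the commutative square *)

Section Isomorphisms.
Variables (K : comNzRingType) (k : K).
Hypothesis k3 : 3 * k = 1.

Lemma third_alg (R : comAlgType K) : 3 * k%:A = 1 :> R.
Proof.
by rewrite -scalerAr mulr1 -scaler_nat scalerA [k * _]mulrC k3 scale1r.
Qed.

(** For C = - A - B the factors A - C and B - C are 2A + B and A + 2B. *)
Lemma discE (R : comAlgType K) (w A B : R) :
  w * ((A - B) * (2 * A + B) * (A + 2 * B)) = 1 ->
  w * disc3 A B (- A - B) = 1.
Proof. by move=> <-; rewrite /disc3; ring. Qed.

Definition base_map (R : comAlgType K)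
    (z : product (U_AB K) (affine_space K L_coord) R) :
    product (U_AB K) (affine_space K P_coord) R :=
  (z.1, cube (sval z.1 cA) (sval z.1 cB) z.2).

Lemma base_map_natural (R S : comAlgType K) (f : {lrmorphism R -> S}) z :
  base_map (fmap _ f z) = fmap _ f (base_map z).
Proof. by congr pair; apply: cube_natural. Qed.

Definition base_iso := Morphism base_map_natural.

Lemma base_isoP : is_isomorphism base_iso.
Proof.
apply: bijective_isomorphism => R.
  (* Both points lie over the same (A, B), so a single [w] serves to invert [cube] on both. *)
  move=> [[ab1 [w wD]] L1] [[ab2 U2] L2] /= [eab]; move: U2; rewrite -eab => U2.
  have wD' := discE wD.
  move=> eL; congr pair; first exact: eq_exist.
  by rewrite -[L1](cubeK wD' (third_alg R)) eL (cubeK wD' (third_alg R)).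
move=> [[ab U] P]; have [w wD] := U; have wD' := discE wD.
exists (exist _ ab U, cube_inv w k%:A (ab cA) (ab cB) P).
by rewrite /= /base_map /= (cube_invK wD' (third_alg R)).
Qed.

Lemma total_map_equations (R : comAlgType K) (z : Pi15_tilde_open K R) :
  H_equations (H_of_Pi ((sval (sval z)).2.1 cA) ((sval (sval z)).2.1 cB)
                 (sval (sval (sval z)).1)).
Proof.
case: z => -[[[x xPi] [ab L]] /= ebase] [w wD].
apply/(H_of_Pi_iff _ (discE wD)) => //.
by split; [exact: (congr1 (@^~ t1) ebase)|exact: (congr1 (@^~ t2) ebase)].
Qed.

Definition total_map (R : comAlgType K) (z : Pi15_tilde_open K R) :
    product (U_AB K) (H13 K) R :=
  (open_restriction (Pi15_tilde_AB K) (AB_disc K) R z,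
   exist (@H_equations K R) _ (total_map_equations z)).

Lemma total_map_natural (R S : comAlgType K) (f : {lrmorphism R -> S}) z :
  total_map (fmap _ f z) = fmap _ f (total_map z).
Proof.
congr pair; first exact: natural.
by apply: eq_exist; apply: H_of_Pi_natural.
Qed.

Definition total_iso := Morphism total_map_natural.

Lemma total_isoP : is_isomorphism total_iso.
Proof.
apply: bijective_isomorphism => R.
  move=> [[[[x X] [ab L]] e] [w wD]] [[[[x' X'] [ab' L']] e'] U'] zz'.
  have eab : ab = ab' := congr1 (fun y => sval y.1) zz'.
  have eH : H_of_Pi (ab cA) (ab cB) x = H_of_Pi (ab' cA) (ab' cB) x' :=
    congr1 (fun y => sval y.2) zz'.
  have base : on_base (ab cA) (ab cB) x.
    by split; [exact: (congr1 (@^~ t1) e)|exact: (congr1 (@^~ t2) e)].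
  have base' : on_base (ab cA) (ab cB) x'.
    by rewrite eab; split;
      [exact: (congr1 (@^~ t1) e')|exact: (congr1 (@^~ t2) e')].
  have wD' : w * disc3 (ab cA) (ab cB) (- ab cA - ab cB) = 1 := discE wD.
  have exx' : x = x'.
    rewrite -(H_of_PiK wD' (third_alg R) base) eH -eab.
    exact (H_of_PiK wD' (third_alg R) base').
  (* The fibre product condition makes L a function of [x]. *)
  have eL : L = L'.
    apply/funext => l; transitivity (x (Pi_base (base_L l))).
      exact/esym/(congr1 (@^~ (base_L l)) e).
    by rewrite exx'; exact: (congr1 (@^~ (base_L l)) e').
  do 2!apply: eq_exist; congr pair; first exact: eq_exist.
  by rewrite eab eL.
move=> [[ab U] [y yH]]; have [w wD] := U; have wD' := discE wD.
pose x := Pi_of_H w k%:A (ab cA) (ab cB) y.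
have xy : H_of_Pi (ab cA) (ab cB) x = y := Pi_of_HK wD' (third_alg R) y.
have X : Pi_equations x.
  apply/(H_of_Pi_iff (Pi_of_H_on_base w k%:A (ab cA) (ab cB) y) wD').
  by rewrite xy.
have e : Pi15_to_base K R (exist _ x X) = b_morphism K R (ab, Lcoords x).
  by apply/funext => -[||l].
exists (exist _ (exist _ (exist _ x X, (ab, Lcoords x)) e) U).
by congr pair; apply: eq_exist.
Qed.

Lemma total_iso_over_base :
  eq_morphism (comp_morphism (id_times (U_AB K) (p_H K)) total_iso)
    (comp_morphism base_iso (p_Pi_open K)).
Proof.
move=> R [[[[x X] [ab L]] e] U]; congr pair.
have eL : Lcoords x = L.
  by apply/funext => l; exact: (congr1 (@^~ (base_L l)) e).
exact: (congr1 (cube (ab cA) (ab cB)) eL).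
Qed.

End Isomorphisms.

Theorem proposition9p6 (RR : realType) :
  exists (beta : morphism
            (product (U_AB RR[i]) (affine_space RR[i] L_coord))
            (product (U_AB RR[i]) (affine_space RR[i] P_coord)))
         (alpha : morphism
            (Pi15_tilde_open RR[i])
            (product (U_AB RR[i]) (H13 RR[i]))),
    is_isomorphism beta /\
    is_isomorphism alpha /\
    eq_morphism
      (comp_morphism (id_times (U_AB RR[i]) (p_H RR[i])) alpha)
      (comp_morphism beta (p_Pi_open RR[i])).
Proof.
(* Characteristic zero enters here, through the invertibility of 3. *)
have third : 3 * 3^-1 = 1 :> RR[i] by rewrite mulfV // Num.Theory.pnatr_eq0.
exists (base_iso _), (total_iso _); split; first exact: base_isoP third.
by split; [exact: total_isoP third|exact: total_iso_over_base].
Qed.
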